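(* Let $Q$ be a strong commutative semicartesian quantale and $X$ a $Q$-set. Then $X$ is Scott-complete if and only if there is a natural isomorphism of presheaves on $\mathbf{QSet}_f$ $$\mathbf{QSet}_f(-,X)\;\cong\;\mathbf{QSet}_r(\Gamma(-),X),$$ i.e. the presheaf represented by $X$ in $\mathbf{QSet}_f$ is isomorphic to the presheaf represented by $X$ in $\mathbf{QSet}_r$ precomposed with the graph functor $\Gamma$.
   Context: A quantale is a complete lattice $(Q,\le)$ with an associative binary operation $\otimes$ that distributes over arbitrary suprema in each variable. It is commutative if $\otimes$ is commutative; semicartesian if $a\otimes b\le a\wedge b$ for all $a,b$; strong if for every $e\in Q$ with $e=e\otimes e$ and every $A\subseteq Q$, $e\le\bigvee_{a\in A}a$ implies $e\le\bigvee_{a\in A}a\otimes a$. A $Q$-set is a set $X$ with a map $\delta:X\times X\to Q$ such that for all $x,y,z$: $\delta(x,y)=\delta(y,x)$; $\delta(x,y)\otimes\delta(y,z)\le\delta(x,z)$; $\delta(x,x)\otimes\delta(x,y)=\delta(x,y)$. The extent of $x$ is $Ex:=\delta(x,x)$. $\mathbf{QSet}_f$ is the category of $Q$-sets with functional morphisms: functions $f:X\to Y$ with $\delta(x,x')\le\delta(f(x),f(x'))$ and $Ef(x)=Ex$, composed as functions. A relational morphism $\phi:X\to Y$ is a function $\phi:X\times Y\to Q$ such that for all $x,x'\in X$, $y,y'\in Y$: $\delta(x,x')\otimes\phi(x,y)\le\phi(x',y)$; $\phi(x,y)\otimes\delta(y,y')\le\phi(x,y')$; $\phi(x,y)\otimes\phi(x,y')\le\delta(y,y')$;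 $\phi(x,y)\otimes Ey=\phi(x,y)$; $Ex\otimes\phi(x,y)=\phi(x,y)$; $\bigvee_{y\in Y}\phi(x,y)=Ex$. Composition is $[\psi\circ\phi](x,z)=\bigvee_{y\in Y}\phi(x,y)\otimes\psi(y,z)$ and the identity of $X$ is $\delta_X$; this is the category $\mathbf{QSet}_r$. The graph functor $\Gamma:\mathbf{QSet}_f\to\mathbf{QSet}_r$ is the identity on objects and $(\Gamma f)(x,y)=\delta(f(x),y)$. A singleton on $X$ is a map $\sigma:X\to Q$ such that for all $x,y\in X$: $\sigma(x)\otimes Ex=\sigma(x)$; $\sigma(x)\otimes\delta(x,y)\le\sigma(y)$; $\sigma(x)\otimes\sigma(y)\le\delta(x,y)$; $\sigma(x)\otimes\bigvee_{y\in X}\sigma(y)=\sigma(x)$. An element $x_\sigma\in X$ represents $\sigma$ if $\sigma(y)=\delta(y,x_\sigma)$ for all $y\in X$. $X$ is Scott-complete if every singleton on $X$ has exactly one representing element. *)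

(* Defs.v *)
From HB Require Import structures.
From mathcomp Require Import all_boot all_order.
From mathcomp Require Import boolp classical_sets.

Set Implicit Arguments.
Unset Strict Implicit.
Unset Printing Implicit Defensive.

Import Order.TTheory.
Local Open Scope order_scope.

(** * Quantales *)

HB.mixin Record Lattice_isComplete (d : Order.disp_t) Q of Order.Lattice d Q := {
  qsup : set Q -> Q;
  qsup_isLub : forall A : set Q, isLub A (qsup A);
}.

#[short(type="completeLatticeType")]
HB.structure Definition CompleteLattice (d : Order.disp_t) :=
  { Q of Order.Lattice d Q & Lattice_isComplete d Q }.

HB.mixin Record CompleteLattice_isQuantale (d : Order.disp_t) Q
    of CompleteLattice d Q := {
  qmul : Q -> Q -> Q;
  qmulA : associative qmul;
  qmul_supl : forall (A : set Q) (b : Q),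
    qmul (qsup A) b = qsup [set qmul a b | a in A]%classic;
  qmul_supr : forall (a : Q) (B : set Q),
    qmul a (qsup B) = qsup [set qmul a b | b in B]%classic;
}.

#[short(type="quantaleType")]
HB.structure Definition Quantale (d : Order.disp_t) :=
  { Q of CompleteLattice d Q & CompleteLattice_isQuantale d Q }.

Notation "a ⊗ b" := (qmul a b) (at level 40, left associativity) : order_scope.

HB.mixin Record Quantale_isComSemicartesian (d : Order.disp_t) Q
    of Quantale d Q := {
  qmulC : commutative (@qmul d Q);
  qmul_leI : forall a b : Q, a ⊗ b <= a `&` b;
}.

#[short(type="comSemicartesianQuantaleType")]
HB.structure Definition ComSemicartesianQuantale (d : Order.disp_t) :=
  { Q of Quantale d Q & Quantale_isComSemicartesian d Q }.

Definition strong (d : Order.disp_t) (Q : quantaleType d) : Prop :=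
  forall (e : Q) (A : set Q), e = e ⊗ e ->
    e <= qsup A -> e <= qsup [set a ⊗ a | a in A]%classic.

Section QuantaleTheory.
Context {d : Order.disp_t} {Q : quantaleType d}.
Implicit Types (a b c : Q) (A : set Q).

Lemma qsup_ub A a : A a -> a <= qsup A.
Proof. by move=> Aa; apply: (qsup_isLub A).1. Qed.

Lemma qsup_le A b : (forall a, A a -> a <= b) -> qsup A <= b.
Proof. by move=> Ab; apply: (qsup_isLub A).2. Qed.

Lemma qsup_set1 a : qsup [set a]%classic = a.
Proof.
apply/le_anti/andP; split; first by apply: qsup_le => _ ->.
exact: qsup_ub.
Qed.

Lemma range_ub (I : Type) (F : I -> Q) (i : I) : F i <= qsup (range F).
Proof. by apply: qsup_ub; exists i. Qed.

Lemma range_le (I : Type) (F : I -> Q) b :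
  (forall i, F i <= b) -> qsup (range F) <= b.
Proof. by move=> Fb; apply: qsup_le => _ [i _ <-]. Qed.

Lemma qmul_rangel (I : Type) (F : I -> Q) b :
  qsup (range F) ⊗ b = qsup (range (fun i => F i ⊗ b)).
Proof.
by rewrite qmul_supl; congr qsup; rewrite image_comp.
Qed.

Lemma qmul_ranger (I : Type) (F : I -> Q) b :
  b ⊗ qsup (range F) = qsup (range (fun i => b ⊗ F i)).
Proof.
by rewrite qmul_supr; congr qsup; rewrite image_comp.
Qed.

Lemma qmul_le2l a b c : a <= b -> c ⊗ a <= c ⊗ b.
Proof.
move=> ab; have -> : b = qsup [set a; b]%classic.
  apply/le_anti/andP; split; first by apply: qsup_ub; right.
  by apply: qsup_le => _ [] ->.
by rewrite qmul_supr; apply: qsup_ub; exists a => //; left.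
Qed.

Lemma qmul_le2r a b c : a <= b -> a ⊗ c <= b ⊗ c.
Proof.
move=> ab; have -> : b = qsup [set a; b]%classic.
  apply/le_anti/andP; split; first by apply: qsup_ub; right.
  by apply: qsup_le => _ [] ->.
by rewrite qmul_supl; apply: qsup_ub; exists a => //; left.
Qed.

Lemma qmul_le2 a b a' b' : a <= a' -> b <= b' -> a ⊗ b <= a' ⊗ b'.
Proof. by move=> h k; apply: le_trans (qmul_le2r _ h) (qmul_le2l _ k). Qed.

Lemma eq_qsup_range (I : Type) (F G : I -> Q) :
  (forall i, F i = G i) -> qsup (range F) = qsup (range G).
Proof. by move=> /funext ->. Qed.

Lemma range_exchange (I J : Type) (F : I -> J -> Q) :
  qsup (range (fun i => qsup (range (F i)))) =
  qsup (range (fun j => qsup (range (fun i => F i j)))).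
Proof.
apply/le_anti/andP; split; apply: range_le => i; apply: range_le => j.
  by apply: le_trans (range_ub _ j); apply: (range_ub (fun i => F i j)).
by apply: le_trans (range_ub _ j); apply: (range_ub (F j)).
Qed.

End QuantaleTheory.

Section ComSemicartesianTheory.
Context {d : Order.disp_t} {Q : comSemicartesianQuantaleType d}.
Implicit Types (a b : Q).

Lemma qmul_lel a b : a ⊗ b <= a.
Proof. by have := qmul_leI a b; rewrite lexI => /andP[]. Qed.

Lemma qmul_ler a b : a ⊗ b <= b.
Proof. by have := qmul_leI a b; rewrite lexI => /andP[]. Qed.

End ComSemicartesianTheory.

(** * Categories, functors, presheaves *)

(* Morphisms are compared by Leibniz equality; for the concrete categories
   below this is pointwise equality of the underlying functions, by functional
   extensionality and proof irrelevance. *)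

Record category := Category {
  ob :> Type;
  hom : ob -> ob -> Type;
  idm : forall X, hom X X;
  comp : forall X Y Z, hom Y Z -> hom X Y -> hom X Z;
  comp_idl : forall X Y (f : hom X Y), comp (idm Y) f = f;
  comp_idr : forall X Y (f : hom X Y), comp f (idm X) = f;
  compA : forall X Y Z W (h : hom Z W) (g : hom Y Z) (f : hom X Y),
    comp h (comp g f) = comp (comp h g) f;
}.
Arguments hom {c} X Y.
Arguments idm {c} X.
Arguments comp {c X Y Z} g f.

Definition op (C : category) : category :=
  @Category (ob C) (fun X Y => @hom C Y X) (fun X => idm X)
    (fun X Y Z g f => comp f g)
    (fun X Y f => comp_idr f) (fun X Y f => comp_idl f)
    (fun X Y Z W h g f => esym (compA f g h)).

Definition Types : category :=
  @Category Type (fun A B => A -> B) (fun A x => x)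
    (fun A B C g f x => g (f x))
    (fun A B f => erefl) (fun A B f => erefl)
    (fun A B C D h g f => erefl).

Record functor (C D : category) := Functor {
  fobj :> C -> D;
  fmap : forall X Y : C, hom X Y -> hom (fobj X) (fobj Y);
  fmap_id : forall X : C, fmap (idm X) = idm (fobj X);
  fmap_comp : forall (X Y Z : C) (g : hom Y Z) (f : hom X Y),
    fmap (comp g f) = comp (fmap g) (fmap f);
}.
Arguments fmap {C D} F {X Y} f : rename.

Definition functor_comp (C D E : category)
    (G : functor D E) (F : functor C D) : functor C E.
Proof.
refine (@Functor C E (fun X => G (F X)) (fun X Y f => fmap G (fmap F f)) _ _).
- by move=> X; rewrite !fmap_id.
- by move=> X Y Z g f; rewrite !fmap_comp.
Defined.

Definition functor_op (C D : category) (F : functor C D) :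
    functor (op C) (op D) :=
  @Functor (op C) (op D) (fun X => F X) (fun X Y f => fmap F f)
    (fun X => fmap_id F X) (fun X Y Z g f => fmap_comp F f g).

Definition presheaf (C : category) := functor (op C) Types.

Definition representable (C : category) (X : C) : presheaf C.
Proof.
refine (@Functor (op C) Types (fun Y : C => @hom C Y X)
  (fun Y Z (f : @hom C Z Y) (g : @hom C Y X) => comp g f) _ _).
- by move=> Y; apply: funext => g; apply: comp_idr.
- by move=> Y Z W g f; apply: funext => h; apply: (compA h f g).
Defined.

Definition is_iso (C : category) (X Y : C) (f : hom X Y) : Prop :=
  exists g : hom Y X, comp g f = idm X /\ comp f g = idm Y.

Definition natural (C D : category) (F G : functor C D)
    (alpha : forall X : C, hom (F X) (G X)) : Prop :=
  forall (X Y : C) (f : hom X Y),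
    comp (alpha Y) (fmap F f) = comp (fmap G f) (alpha X).

(* Only the components are asked to be invertible: their inverses are then
   automatically natural. *)
Definition naturally_isomorphic (C D : category) (F G : functor C D) : Prop :=
  exists alpha : forall X : C, hom (F X) (G X),
    natural alpha /\ forall X : C, is_iso (alpha X).

(** * Q-sets *)

Record qset (d : Order.disp_t) (Q : quantaleType d) := QSet {
  qcar :> Type;
  delta : qcar -> qcar -> Q;
  delta_sym : forall x y, delta x y = delta y x;
  delta_trans : forall x y z, delta x y ⊗ delta y z <= delta x z;
  delta_ext : forall x y, delta x x ⊗ delta x y = delta x y;
}.
Arguments delta {d Q q} x y.

Definition extent (d : Order.disp_t) (Q : quantaleType d) (X : qset Q) (x : X) : Q :=
  delta x x.

Record fmorph (d : Order.disp_t) (Q : quantaleType d) (X Y : qset Q) := FMorph {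
  fmorph_fun :> X -> Y;
  fmorph_delta : forall x x' : X,
    delta x x' <= delta (fmorph_fun x) (fmorph_fun x');
  fmorph_extent : forall x : X, extent (fmorph_fun x) = extent x;
}.

Record rmorph (d : Order.disp_t) (Q : quantaleType d) (X Y : qset Q) := RMorph {
  rmorph_fun :> X -> Y -> Q;
  rmorph_left : forall (x x' : X) (y : Y),
    delta x x' ⊗ rmorph_fun x y <= rmorph_fun x' y;
  rmorph_right : forall (x : X) (y y' : Y),
    rmorph_fun x y ⊗ delta y y' <= rmorph_fun x y';
  rmorph_functional : forall (x : X) (y y' : Y),
    rmorph_fun x y ⊗ rmorph_fun x y' <= delta y y';
  rmorph_extr : forall (x : X) (y : Y), rmorph_fun x y ⊗ extent y = rmorph_fun x y;
  rmorph_extl : forall (x : X) (y : Y), extent x ⊗ rmorph_fun x y = rmorph_fun x y;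
  rmorph_total : forall x : X, qsup (range (rmorph_fun x)) = extent x;
}.

(* Commutativity and semicartesianness are needed already for delta and the
   composites below to satisfy the axioms of relational morphisms. *)
Section QSetCategories.
Context {d : Order.disp_t} {Q : comSemicartesianQuantaleType d}.
Implicit Types X Y Z W : qset Q.

Lemma fmorph_eq X Y (f g : fmorph X Y) : (forall x, f x = g x) -> f = g.
Proof.
case: f g => [f f1 f2] [g g1 g2] /= /funext fg; subst g.
by congr FMorph; apply: Prop_irrelevance.
Qed.

Lemma rmorph_eq X Y (f g : rmorph X Y) : (forall x y, f x y = g x y) -> f = g.
Proof.
case: f g => [f ? ? ? ? ? ?] [g ? ? ? ? ? ?] /= fg.
have {}fg : f = g by apply: funext => x; apply: funext => y.
by subst g; congr RMorph; apply: Prop_irrelevance.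
Qed.

Definition fid X : fmorph X X :=
  @FMorph d Q X X id (fun x x' => lexx _) (fun x => erefl).

Definition fcomp X Y Z (g : fmorph Y Z) (f : fmorph X Y) : fmorph X Z.
Proof.
refine (@FMorph d Q X Z (fun x => g (f x)) _ _).
- by move=> x x'; apply: le_trans (fmorph_delta f x x') (fmorph_delta g _ _).
- by move=> x; rewrite !fmorph_extent.
Defined.

Definition QSetf : category.
Proof.
refine (@Category (qset Q) (@fmorph d Q) fid fcomp _ _ _).
- by move=> X Y f; apply: fmorph_eq.
- by move=> X Y f; apply: fmorph_eq.
- by move=> X Y Z W h g f; apply: fmorph_eq.
Defined.

Lemma delta_le_extl X (x y : X) : delta x y <= extent x.
Proof. by rewrite -delta_ext; apply: qmul_lel. Qed.

Lemma delta_extr X (x y : X) : delta x y ⊗ extent y = delta x y.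
Proof. by rewrite qmulC /extent (delta_sym x y) delta_ext. Qed.

Lemma delta_total X (x : X) : qsup (range (delta x)) = extent x.
Proof.
apply/le_anti/andP; split; first by apply: range_le => y; apply: delta_le_extl.
exact: (range_ub (delta x) x).
Qed.

Definition rid X : rmorph X X.
Proof.
refine (@RMorph d Q X X (@delta d Q X) _ _ _ _ _ _).
- by move=> x x' y; rewrite (delta_sym x x'); apply: delta_trans.
- exact: delta_trans.
- by move=> x y y'; rewrite (delta_sym x y); apply: delta_trans.
- exact: delta_extr.
- exact: delta_ext.
- exact: delta_total.
Defined.

Definition rcomp_fun X Y Z (psi : rmorph Y Z) (phi : rmorph X Y) (x : X) (z : Z) : Q :=
  qsup (range (fun y : Y => phi x y ⊗ psi y z)).

Definition rcomp X Y Z (psi : rmorph Y Z) (phi : rmorph X Y) : rmorph X Z.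
Proof.
refine (@RMorph d Q X Z (rcomp_fun psi phi) _ _ _ _ _ _); rewrite /rcomp_fun.
- move=> x x' z; rewrite qmul_ranger; apply: range_le => y.
  apply: le_trans (range_ub _ y); rewrite qmulA.
  exact/qmul_le2r/rmorph_left.
- move=> x z z'; rewrite qmul_rangel; apply: range_le => y.
  apply: le_trans (range_ub _ y); rewrite -qmulA.
  exact/qmul_le2l/rmorph_right.
- move=> x z z'; rewrite qmul_rangel; apply: range_le => y.
  rewrite qmul_ranger; apply: range_le => y'.
  have -> : phi x y ⊗ psi y z ⊗ (phi x y' ⊗ psi y' z') =
            (phi x y ⊗ phi x y') ⊗ psi y z ⊗ psi y' z'.
    rewrite !qmulA; congr (_ ⊗ _); rewrite -!qmulA; congr (_ ⊗ _).
    exact: qmulC.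
  apply: le_trans (rmorph_functional psi y' z z').
  apply: qmul_le2r; apply: le_trans (rmorph_left psi y y' z).
  exact/qmul_le2r/rmorph_functional.
- move=> x z; rewrite qmul_rangel; apply: eq_qsup_range => y.
  by rewrite -qmulA rmorph_extr.
- move=> x z; rewrite qmul_ranger; apply: eq_qsup_range => y.
  by rewrite qmulA rmorph_extl.
- move=> x; rewrite range_exchange -(rmorph_total phi).
  apply: eq_qsup_range => y.
  by rewrite -qmul_ranger rmorph_total rmorph_extr.
Defined.

Lemma rcomp_idl X Y (phi : rmorph X Y) : rcomp (rid Y) phi = phi.
Proof.
apply: rmorph_eq => x y /=; apply/le_anti/andP; split.
  by apply: range_le => y'; apply: rmorph_right.
by apply: le_trans (range_ub _ y); rewrite rmorph_extr.
Qed.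

Lemma rcomp_idr X Y (phi : rmorph X Y) : rcomp phi (rid X) = phi.
Proof.
apply: rmorph_eq => x y /=; apply/le_anti/andP; split.
  apply: range_le => x' /=; rewrite (delta_sym x x'); exact: rmorph_left.
by apply: le_trans (range_ub _ x); rewrite rmorph_extl.
Qed.

Lemma rcompA X Y Z W (h : rmorph Z W) (g : rmorph Y Z) (f : rmorph X Y) :
  rcomp h (rcomp g f) = rcomp (rcomp h g) f.
Proof.
apply: rmorph_eq => x w /=; rewrite /rcomp_fun /= /rcomp_fun.
under eq_fun do rewrite qmul_rangel.
rewrite range_exchange; apply: eq_qsup_range => y.
by rewrite qmul_ranger; apply: eq_qsup_range => z; rewrite qmulA.
Qed.

Definition QSetr : category :=
  @Category (qset Q) (@rmorph d Q) rid rcomp rcomp_idl rcomp_idr rcompA.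

Definition graph_rel X Y (f : fmorph X Y) : rmorph X Y.
Proof.
refine (@RMorph d Q X Y (fun x y => delta (f x) y) _ _ _ _ _ _).
- move=> x x' y; apply: le_trans (delta_trans (f x') (f x) y).
  by apply: qmul_le2r; rewrite (delta_sym (f x')); apply: fmorph_delta.
- by move=> x y y'; apply: delta_trans.
- by move=> x y y'; rewrite (delta_sym (f x) y); apply: delta_trans.
- by move=> x y; apply: delta_extr.
- by move=> x y; rewrite -(fmorph_extent f) delta_ext.
- by move=> x; rewrite delta_total fmorph_extent.
Defined.

Definition Graph : functor QSetf QSetr.
Proof.
refine (@Functor QSetf QSetr (fun X => X) graph_rel _ _).
- by move=> X; apply: rmorph_eq.
- move=> X Y Z g f; apply: rmorph_eq => x z /=.
  apply/le_anti/andP; split; last first.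
    apply: range_le => y /=; apply: le_trans (delta_trans _ (g y) _).
    by apply: qmul_le2r; apply: fmorph_delta.
  apply: le_trans (range_ub _ (f x)) => /=.
  by rewrite -/(extent (f x)) -(fmorph_extent g) delta_ext.
Defined.

End QSetCategories.
Arguments QSetf {d} Q.
Arguments QSetr {d} Q.
Arguments Graph {d} Q.

(** * Singletons and Scott-completeness *)

Record singleton (d : Order.disp_t) (Q : quantaleType d) (X : qset Q)
    (sigma : X -> Q) : Prop := Singleton {
  singleton_ext : forall x : X, sigma x ⊗ extent x = sigma x;
  singleton_delta : forall x y : X, sigma x ⊗ delta x y <= sigma y;
  singleton_functional : forall x y : X, sigma x ⊗ sigma y <= delta x y;
  singleton_total : forall x : X, sigma x ⊗ qsup (range sigma) = sigma x;
}.

Definition represents (d : Order.disp_t) (Q : quantaleType d) (X : qset Q)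
    (x : X) (sigma : X -> Q) : Prop :=
  forall y : X, sigma y = delta y x.

Definition scott_complete (d : Order.disp_t) (Q : quantaleType d) (X : qset Q) : Prop :=
  forall sigma : X -> Q, singleton sigma -> exists! x : X, represents x sigma.

(* Main.v *)
Require Import Defs.
From mathcomp Require Import all_boot all_order.
From mathcomp Require Import boolp classical_sets.

(** If [X] is Scott-complete, the graph map [f |-> graph_rel f] is itself the
natural isomorphism: each row [phi y] of a relational morphism [phi : Y -> X] is
a singleton, and choosing the unique representing element of every row turns
[phi] into a function whose graph is [phi].

Conversely, an arbitrary natural isomorphism [alpha] is, by the Yoneda lemma,
given by its universal element [phi := alpha X id : X -> X], namely
[alpha Y f y x = phi (f y) x].  Evaluated at one-point Q-sets it says that
[x |-> phi x] is a bijection from [X] onto the singletons on [X].  Since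
[alpha] is arbitrary, [phi x] need not be the singleton [delta x] itself.
The kernel [K x x' = \/_z phi x z ⊗ phi x' z] is a second Q-set structure on
the carrier of [X]; strength of [Q] gives it the same extents as [X], and
[delta <= K].  The relation [phi] is also a relational morphism from [(X, K)] to
[X], so it comes from a functional morphism [(X, K) -> X], which injectivity of
[x |-> phi x] forces to be the identity map; hence [K = delta].

A singleton [sigma] is now represented by the element [x] whose row [phi x] is
the composite singleton [\/_y sigma y ⊗ phi y z], because
[delta y x = K y x = \/_y' sigma y' ⊗ K y' y = \/_y' sigma y' ⊗ delta y' y]
and the last supremum is [sigma y].  The representing element is unique since
[phi x] only depends on [delta x]. *)

Set Implicit Arguments.
Unset Strict Implicit.
Unset Printing Implicit Defensive.

Import Order.TTheory.
Local Open Scope order_scope.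

Section ScottCompleteness.
Context {d : Order.disp_t} {Q : comSemicartesianQuantaleType d}.
Implicit Types X Y : qset Q.

(** * Relational morphisms and graphs *)

Lemma rcomp_graph X Y Z (phi : rmorph Y Z) (f : fmorph X Y) x z :
  rcomp phi (graph_rel f) x z = phi (f x) z.
Proof.
exact: (congr1 (fun psi : rmorph Y Z => psi (f x) z) (rcomp_idr phi)).
Qed.

Lemma rmorph_singleton X Y (phi : rmorph X Y) x : singleton (phi x).
Proof.
split=> [y|y y'|y y'|y]; first exact: rmorph_extr.
- exact: rmorph_right.
- exact: rmorph_functional.
- by rewrite rmorph_total qmulC rmorph_extl.
Qed.

Lemma represents_extent X (x : X) (sigma : X -> Q) :
  represents x sigma -> extent x = qsup (range sigma).
Proof.
move=> xsigma; rewrite -delta_total; apply: eq_qsup_range => y.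
by rewrite xsigma delta_sym.
Qed.

Lemma rmorph_of_representatives X Y (phi : rmorph Y X) (f : Y -> X) :
  (forall y, represents (f y) (phi y)) ->
  exists g : fmorph Y X, graph_rel g = phi.
Proof.
move=> fphi.
have fE y : extent (f y) = extent y.
  by rewrite (represents_extent (fphi y)) rmorph_total.
have fdelta y y' : delta y y' <= delta (f y) (f y').
  have := rmorph_left phi y y' (f y).
  by rewrite !fphi -/(extent (f y)) fE delta_sym delta_extr delta_sym.
exists (FMorph fdelta fE); apply: rmorph_eq => y x /=.
by rewrite fphi delta_sym.
Qed.

Lemma scott_complete_graph_inj X Y (f g : fmorph Y X) :
  scott_complete X -> graph_rel f = graph_rel g -> f = g.
Proof.
move=> Xc fg; apply: fmorph_eq => y.
have [x [_ xuniq]] := Xc _ (rmorph_singleton (graph_rel f) y).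
rewrite -(xuniq (f y)) => [|x']; last exact: delta_sym.
by rewrite -(xuniq (g y)) // => x'; rewrite fg; apply: delta_sym.
Qed.

Lemma scott_complete_graph_surj X Y (phi : rmorph Y X) :
  scott_complete X -> exists f : fmorph Y X, graph_rel f = phi.
Proof.
move=> Xc.
have /choice[f fphi] y : exists x : X, represents x (phi y).
  by have [x [xphi _]] := Xc _ (rmorph_singleton phi y); exists x.
exact: rmorph_of_representatives fphi.
Qed.

(** * One-point Q-sets *)

Lemma singleton_idem X (sigma : X -> Q) :
  singleton sigma ->
  qsup (range sigma) ⊗ qsup (range sigma) = qsup (range sigma).
Proof.
move=> sS; rewrite qmul_rangel; apply: eq_qsup_range => x.
exact: singleton_total.
Qed.

Lemma extent_idem X (x : X) : extent x ⊗ extent x = extent x.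
Proof. exact: delta_ext. Qed.

Definition point (e : Q) (ee : e ⊗ e = e) : qset Q.
Proof.
by refine (@QSet d Q unit (fun _ _ => e) _ _ _) => // *; rewrite ee.
Defined.

Definition fpoint X (e : Q) (ee : e ⊗ e = e) (x : X) (xe : extent x = e) :
  fmorph (point ee) X.
Proof.
refine (@FMorph d Q (point ee) X (fun _ => x) _ (fun _ => xe)).
by move=> ? ?; rewrite -/(extent x) xe.
Defined.

Definition rpoint X (sigma : X -> Q) (sS : singleton sigma) :
  rmorph (point (singleton_idem sS)) X.
Proof.
refine (@RMorph d Q (point _) X (fun _ => sigma) _ _ _ _ _ _) => //.
- by move=> ? ? y; apply: qmul_ler.
- by move=> ?; apply: singleton_delta.
- by move=> ?; apply: singleton_functional.
- by move=> ?; apply: singleton_ext.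
- by move=> ? y; rewrite qmulC; apply: singleton_total.
Defined.

(** * The kernel of a relational morphism *)

Section Kernel.
Hypothesis strongQ : strong Q.
Context {X Y : qset Q} (phi : rmorph X Y).

Definition kernel_rel (x x' : X) : Q :=
  qsup (range (fun y => phi x y ⊗ phi x' y)).

(** Strength upgrades [Ex = \/_y phi x y] to [Ex = \/_y phi x y ⊗ phi x y],
because [Ex] is idempotent. *)
Lemma kernel_extent x : kernel_rel x x = extent x.
Proof.
apply/le_anti/andP; split; rewrite -{1}(rmorph_total phi x).
  by apply: range_le => y; apply: le_trans (range_ub _ y); apply: qmul_lel.
rewrite rmorph_total /kernel_rel.
have := strongQ (A := range (phi x)) (esym (extent_idem x)).
by rewrite rmorph_total lexx image_comp; apply.
Qed.

Lemma kernel_left x x' y : kernel_rel x x' ⊗ phi x y <= phi x' y.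
Proof.
rewrite qmul_rangel; apply: range_le => y'.
apply: le_trans (rmorph_right phi x' y' y).
rewrite (qmulC (phi x y')) -qmulA.
exact/qmul_le2l/rmorph_functional.
Qed.

Lemma kernel_sym x x' : kernel_rel x x' = kernel_rel x' x.
Proof. by apply: eq_qsup_range => y; apply: qmulC. Qed.

Lemma kernel_trans x1 x2 x3 :
  kernel_rel x1 x2 ⊗ kernel_rel x2 x3 <= kernel_rel x1 x3.
Proof.
rewrite [X in _ ⊗ X]/kernel_rel qmul_ranger; apply: range_le => y.
apply: le_trans (range_ub _ y); rewrite qmulA.
by rewrite kernel_sym; apply/qmul_le2r/kernel_left.
Qed.

Lemma kernel_ext x x' : kernel_rel x x ⊗ kernel_rel x x' = kernel_rel x x'.
Proof.
rewrite kernel_extent qmul_ranger; apply: eq_qsup_range => y.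
by rewrite qmulA rmorph_extl.
Qed.

Definition kernel : qset Q := QSet kernel_sym kernel_trans kernel_ext.

Definition kernel_rmorph : rmorph kernel Y.
Proof.
refine (@RMorph d Q kernel Y phi kernel_left (rmorph_right phi)
  (rmorph_functional phi) (rmorph_extr phi) _ _) => /=.
- by move=> x y; rewrite /extent /= kernel_extent rmorph_extl.
- by move=> x; rewrite /extent /= kernel_extent rmorph_total.
Defined.

Lemma delta_le_kernel x x' : delta x x' <= kernel_rel x x'.
Proof.
rewrite -delta_ext -/(extent x) -kernel_extent qmulC qmul_ranger.
apply: range_le => y; apply: le_trans (range_ub _ y) => /=.
rewrite qmulA (qmulC (phi x y)).
exact/qmul_le2r/rmorph_left.
Qed.

End Kernel.

(** * Universal relational endomorphisms *)

(** This is how a natural isomorphism between the two presheaves of [X] looks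
through the Yoneda lemma, [phi] being its universal element. *)
Definition universal X (phi : rmorph X X) : Prop :=
  forall Y, bijective (fun f : fmorph Y X => rcomp phi (graph_rel f)).

Section Universal.
Hypothesis strongQ : strong Q.
Context {X : qset Q} {phi : rmorph X X}.
Hypothesis phiU : universal phi.

(** The rows determine the extents by totality, so equal rows come from two maps
out of the same one-point Q-set. *)
Lemma universal_row_inj (x x' : X) : phi x =1 phi x' -> x = x'.
Proof.
move=> xx'.
have x'E : extent x' = extent x.
  by rewrite -!(rmorph_total phi); apply: eq_qsup_range => y; rewrite xx'.
pose f := fpoint (extent_idem x) (erefl (extent x)).
pose f' := fpoint (extent_idem x) x'E.
suff /(bij_inj (phiU _)) : rcomp phi (graph_rel f) = rcomp phi (graph_rel f').
  by move=> /(congr1 (fun g : fmorph (point (extent_idem x)) X => g tt)).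
by apply: rmorph_eq => t z; rewrite !rcomp_graph.
Qed.

Lemma universal_lift Y (psi : rmorph Y X) :
  exists f : fmorph Y X, forall y, phi (f y) =1 psi y.
Proof.
have [g _ gK] := phiU Y; exists (g psi) => y x.
by rewrite -rcomp_graph gK.
Qed.

(** Seen as a relational morphism out of its own kernel, [phi] lifts to a
functional morphism with the rows of [phi], that is, to the identity map. *)
Lemma universal_kernel (x x' : X) : kernel_rel phi x x' = delta x x'.
Proof.
apply/le_anti/andP; split; last exact: delta_le_kernel.
have [f fphi] := universal_lift (kernel_rmorph strongQ phi).
have fid y : f y = y by apply: universal_row_inj; apply: fphi.
by have := fmorph_delta f x x'; rewrite !fid.
Qed.

Lemma universal_represents_uniq (sigma : X -> Q) x x' :
  represents x sigma -> represents x' sigma -> x = x'.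
Proof.
move=> xs x's; apply: universal_row_inj => z.
rewrite -[phi]rcomp_idr /=; apply: eq_qsup_range => y /=.
by rewrite !(delta_sym _ y) -xs x's.
Qed.

Lemma universal_represents (sigma : X -> Q) :
  singleton sigma -> exists x, represents x sigma.
Proof.
move=> sS; have [f fphi] := universal_lift (rcomp phi (rpoint sS)).
exists (f tt) => y; rewrite -universal_kernel /kernel_rel.
under eq_fun => z do rewrite fphi /= /rcomp_fun qmul_ranger.
rewrite range_exchange.
transitivity (qsup (range (fun y' => sigma y' ⊗ delta y' y))); last first.
  apply: eq_qsup_range => y'; rewrite -universal_kernel qmul_ranger.
  by apply: eq_qsup_range => z /=; rewrite qmulA qmulC.
apply/le_anti/andP; split; last first.
  by apply: range_le => y'; apply: singleton_delta.
by apply: le_trans (range_ub _ y); rewrite -/(extent y) singleton_ext.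
Qed.

Lemma universal_scott_complete : scott_complete X.
Proof.
move=> sigma /universal_represents[x xs]; exists x; split=> // x' x's.
exact: universal_represents_uniq xs x's.
Qed.

End Universal.

End ScottCompleteness.

(** * Natural isomorphisms of presheaves *)

Lemma is_iso_bijective (A B : Types) (f : hom A B) : is_iso f <-> bijective f.
Proof.
split=> [[g [fK gK]]|[g fK gK]].
  by exists g => x; [move: (congr1 (@^~ x) fK)|move: (congr1 (@^~ x) gK)].
by exists g; split; apply: funext.
Qed.

Theorem mainTheorem8 (d : Order.disp_t) (Q : comSemicartesianQuantaleType d)
    (strongQ : strong Q) (X : qset Q) :
  scott_complete X <->
  naturally_isomorphic
    (representable (C := QSetf Q) X)
    (functor_comp (representable (C := QSetr Q) X) (functor_op (Graph Q))).
Proof.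
split=> [Xc|[alpha [alpha_nat alpha_iso]]].
  exists (fun Y : qset Q => @graph_rel d Q Y X); split.
    move=> Y Z f; apply: funext => g; exact: (fmap_comp (Graph Q) g f).
  move=> Y; apply/is_iso_bijective.
  have /choice[g gK] := fun phi => @scott_complete_graph_surj d Q X Y phi Xc.
  exists g => // f; apply: scott_complete_graph_inj => //; exact: gK.
pose phi : rmorph X X := alpha X (fid X).
apply: (universal_scott_complete strongQ (phi := phi)) => Y.
(* Naturality at [f], evaluated at the identity of [X]. *)
suff -> : (fun f : fmorph Y X => rcomp phi (graph_rel f)) = alpha Y.
  exact/is_iso_bijective/alpha_iso.
apply: funext => f.
have := congr1 (@^~ (fid X)) (alpha_nat X Y f) => /= <-.
by congr (alpha Y _); apply: fmorph_eq.
Qed.
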